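(* Let $D\subseteq E$ be division rings. Set $\mathfrak{C}=E\otimes_DE$ and let $g=1\otimes_D1$ be the distinguished group-like element. For a coideal $J$ of $\mathfrak{C}$ let $\pi_J:\mathfrak{C}\to\mathfrak{C}/J$ denote the canonical projection. Then the maps $$\mathcal{R}:\mathcal{T}\to\mathcal{S},\quad J\mapsto\{e\in E: e\,\pi_J(g)=\pi_J(g)\,e\},\qquad \mathcal{J}:\mathcal{S}\to\mathcal{T},\quad C\mapsto\mathrm{Ker}(E\otimes_DE\twoheadrightarrow E\otimes_CE)$$ establish a bijective correspondence between the set $\mathcal{S}$ of intermediate division rings $D\subseteq C\subseteq E$ and the set $\mathcal{T}$ of coideals $J$ of $\mathfrak{C}$. Moreover, two intermediate division rings $C$ and $C'$ are conjugated in $E$ if and only if $\mathfrak{C}/\mathcal{J}(C)\cong\mathfrak{C}/\mathcal{J}(C')$ as $E$-corings.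
   Context: An $E$-coring is an $E$-bimodule $\mathfrak{C}$ with $E$-bimodule maps $\Delta:\mathfrak{C}\to\mathfrak{C}\otimes_E\mathfrak{C}$ and $\epsilon:\mathfrak{C}\to E$ that are coassociative and counital. For a division subring $D\subseteq E$, $E\otimes_DE$ is an $E$-coring (the Sweedler coring) with $\Delta(x\otimes_Dy)=(x\otimes_D1)\otimes_E(1\otimes_Dy)$ and $\epsilon(x\otimes_Dy)=xy$. A coideal of $\mathfrak{C}$ is the kernel of a surjective homomorphism of $E$-corings out of $\mathfrak{C}$; equivalently, a sub-bimodule $J$ such that $\mathfrak{C}/J$ has a (unique) coring structure making $\pi_J$ a coring homomorphism. Two subrings $C,C'$ of $E$ are conjugated in $E$ if $C'=uCu^{-1}$ for some unit $u\in E$. *)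

(* Defs.v *)
From HB Require Import structures.
From mathcomp Require Import all_boot all_algebra generic_quotient ring_quotient.
From mathcomp Require Import freeg.
From mathcomp Require Import boolp classical_sets.

Set Implicit Arguments.
Unset Strict Implicit.
Unset Printing Implicit Defensive.

Import GRing.Theory.
Local Open Scope ring_scope.
Local Open Scope quotient_scope.
Local Open Scope classical_set_scope.

HB.mixin Record Lmodule_isBimodule (E : nzRingType) V of GRing.Lmodule E V := {
  rscale : V -> E -> V;
  rscalerA : forall v a b, rscale (rscale v a) b = rscale v (a * b);
  rscaler1 : forall v, rscale v 1 = v;
  rscalerDl : forall u v a, rscale (u + v) a = rscale u a + rscale v a;
  rscalerDr : forall v a b, rscale v (a + b) = rscale v a + rscale v b;
  scaler_rscale : forall a v b, rscale (a *: v) b = a *: rscale v b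
}.

#[short(type="bimodType")]
HB.structure Definition Bimodule (E : nzRingType) :=
  {V of GRing.Lmodule E V & Lmodule_isBimodule E V}.

Notation "v :* a" := (rscale v a) : ring_scope.

HB.instance Definition _ (E : nzRingType) :=
  Lmodule_isBimodule.Build E E^o (rscale := fun x a => (x : E) * a)
    (fun v a b => esym (mulrA v a b)) (@mulr1 E)
    (fun u v a => mulrDl u v a) (fun v a b => mulrDr v a b)
    (fun a v b => esym (mulrA a v b)).

Definition bimod_hom (E : nzRingType) (U V : bimodType E) (f : U -> V) : Prop :=
  linear f /\ forall v a, f (v :* a) = f v :* a.

Section GeneratedSubgroup.
Variable V : zmodType.

Definition gen_pred (S : set V) : V -> bool := fun x =>
  `[< forall H : set V, zmod_closed [in H] -> S `<=` H -> H x >].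

Lemma gen_zmod_closed S : zmod_closed (gen_pred S).
Proof.
split; first by apply/asboolP => H [/set_mem].
move=> x y /asboolP hx /asboolP hy; apply/asboolP => H hH hS.
by apply/set_mem; case: (hH) => _; apply; apply/mem_set; [apply: hx|apply: hy].
Qed.

HB.instance Definition _ S :=
  GRing.isZmodClosed.Build V (gen_pred S) (gen_zmod_closed S).

Definition gen_subgroup (S : set V) : zmodClosed V :=
  GRing.ZmodClosed.clone V (gen_pred S) _.

Lemma gen_subgroupP S x : S x -> x \in gen_subgroup S.
Proof. by move=> Sx; apply/asboolP => H _; apply. Qed.

End GeneratedSubgroup.

(* [tensor D M N] is the tensor product of [M] and [N] over the subring [D] of
   [E], for [E]-bimodules [M] and [N]; taking [D := setT] gives the tensor
   product over [E]. *)
Section Tensor.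
Variables (E : nzRingType) (D : set E) (M N : bimodType E).

Inductive tensor_rel : {freeg (M * N)%type / int} -> Prop :=
| TensorAddl m m' n :
    tensor_rel (<< (m + m', n) >> - (<< (m, n) >> + << (m', n) >>))
| TensorAddr m n n' :
    tensor_rel (<< (m, n + n') >> - (<< (m, n) >> + << (m, n') >>))
| TensorBal m d n : D d -> tensor_rel (<< (m :* d, n) >> - << (m, d *: n) >>).

Definition tensor : Type := Quotient.quot (gen_subgroup tensor_rel).

HB.instance Definition _ := GRing.Zmodule.on tensor.

Definition tens (m : M) (n : N) : tensor :=
  \pi_(Quotient.quot (gen_subgroup tensor_rel)) << (m, n) >>.

Definition balanced (A : zmodType) (f : M -> N -> A) : Prop :=
  [/\ forall m m' n, f (m + m') n = f m n + f m' n,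
      forall m n n', f m (n + n') = f m n + f m n' &
      forall m d n, D d -> f (m :* d) n = f m (d *: n)].

Definition freelift (A : zmodType) (f : M -> N -> A)
    (x : {freeg (M * N)%type / int}) : A :=
  fglift (fun p => f p.1 p.2 : zmodule A) x.

(* Meaningful only for [balanced D f], where it is the additive map induced by
   [f], by [tlift_tens] and [tliftD]; otherwise it depends on [repr]. *)
Definition tlift (A : zmodType) (f : M -> N -> A) (t : tensor) : A :=
  freelift f (repr t).

End Tensor.

Section TensorTheory.
Variables (E : nzRingType) (D : set E) (M N : bimodType E).
Local Notation T := (tensor D M N).
Local Notation Q := (Quotient.quot (gen_subgroup (@tensor_rel E D M N))).

Lemma fliftB (A : zmodType) (f : M -> N -> A) : {morph freelift f : x y / x - y}.
Proof. by move=> x y; exact: (@lift_is_additive _ _ (zmodule A)). Qed.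

Lemma flift0 (A : zmodType) (f : M -> N -> A) : freelift f 0 = 0.
Proof. by rewrite -[X in freelift f X](subrr 0) fliftB subrr. Qed.

Lemma fliftD (A : zmodType) (f : M -> N -> A) : {morph freelift f : x y / x + y}.
Proof. by move=> x y; rewrite -{1}[y]opprK -[- y]sub0r !fliftB flift0 sub0r opprK. Qed.

Lemma flift1 (A : zmodType) (f : M -> N -> A) m n : freelift f << (m, n) >> = f m n.
Proof. by rewrite /freelift liftU scale1r. Qed.

Lemma eq_tens_pi (x y : {freeg (M * N)%type / int}) :
  tensor_rel D (x - y) -> \pi_Q x = \pi_Q y.
Proof.
by move=> r; apply/eqP; rewrite -Quotient.idealrBE; apply: gen_subgroupP.
Qed.

Lemma tens_balanced : balanced D (@tens E D M N).
Proof.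
split=> [m m' n|m n n'|m d n Dd].
- transitivity (\pi_Q (<< (m, n) >> + << (m', n) >>)); last exact: raddfD.
  exact/eq_tens_pi/TensorAddl.
- transitivity (\pi_Q (<< (m, n) >> + << (m, n') >>)); last exact: raddfD.
  exact/eq_tens_pi/TensorAddr.
- exact/eq_tens_pi/TensorBal.
Qed.

Lemma tensDl m m' n : tens D (m + m') n = tens D m n + tens D m' n :> T.
Proof. by case: tens_balanced. Qed.

Lemma tensDr m n n' : tens D m (n + n') = tens D m n + tens D m n' :> T.
Proof. by case: tens_balanced. Qed.

Lemma tens_bal m d n : D d -> tens D (m :* d) n = tens D m (d *: n) :> T.
Proof. by case: tens_balanced => _ _; apply. Qed.

Lemma tens0l n : tens D 0 n = 0 :> T.
Proof. by apply: (addrI (tens D 0 n)); rewrite -tensDl !addr0. Qed.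

Lemma tensNl m n : tens D (- m) n = - tens D m n :> T.
Proof. by apply/(addrI (tens D m n)); rewrite -tensDl !subrr tens0l. Qed.

Lemma tens_ind (P : T -> Prop) :
  (forall m n, P (tens D m n)) -> (forall s t, P s -> P t -> P (s + t)) ->
  forall t, P t.
Proof.
move=> P1 PD t; rewrite -[t](@reprK _ Q).
rewrite -[repr _]freeg_sumE.
have P0 : P 0 by rewrite -(tens0l 0).
set u : {freeg (M * N)%type / int} := repr _.
suff : P (\sum_(z <- dom u) (\pi_Q << coeff z u *g z >> : T)).
  by rewrite -[X in P X](raddf_sum (\pi_Q)).
elim: (dom u) => [|z s IH]; first by rewrite big_nil.
rewrite big_cons; apply: (PD) => //.
case: z => m n; rewrite -[coeff _ _]intz -freegU_mulz.
have -> : \pi_Q (<< (m, n) >> *~ coeff (m, n) u) = tens D m n *~ coeff (m, n) u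
  by exact: raddfMz.
have MnP k : P (tens D m n *+ k).
  by elim: k => [|k IHk]; rewrite ?mulr0n // mulrS; apply: (PD).
have MnN k : P (tens D (- m) n *+ k).
  by elim: k => [|k IHk]; rewrite ?mulr0n // mulrS; apply: (PD).
case: (coeff _ _) => k; first by rewrite -pmulrn.
by rewrite NegzE -nmulrn -mulNrn -tensNl.
Qed.

Section Lift.
Variables (A : zmodType) (f : M -> N -> A).
Hypothesis fb : balanced D f.

Lemma tlift_pi x : tlift f (\pi_Q x : T) = freelift f x.
Proof.
apply/eqP; rewrite -subr_eq0 -fliftB; apply/eqP.
have : repr (\pi_Q x) - x \in gen_subgroup (@tensor_rel E D M N).
  by rewrite Quotient.idealrBE reprK.
move/asboolP/(_ [set y | freelift f y = 0]); apply.
  split; first by rewrite inE /= flift0.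
  by move=> y z; rewrite !inE /= => y0 z0; rewrite fliftB y0 z0 subrr.
case: fb => fDl fDr fB.
by move=> _ [m m' n|m n n'|m d n Dd] /=;
  rewrite fliftB ?fliftD !flift1 ?fDl ?fDr ?fB // subrr.
Qed.

Lemma tlift_tens m n : tlift f (tens D m n) = f m n.
Proof. by rewrite tlift_pi flift1. Qed.

Lemma tliftD : {morph tlift f : s t / (s : T) + t >-> s + t}.
Proof.
move=> s t; rewrite -[s](@reprK _ Q) -[t](@reprK _ Q).
have <- : \pi_Q (repr s + repr t) = \pi_Q (repr s) + \pi_Q (repr t) :> Q
  by exact: raddfD.
by rewrite !tlift_pi fliftD.
Qed.

End Lift.

Lemma tens_ext (A : zmodType) (f g : T -> A) :
  {morph f : x y / x + y} -> {morph g : x y / x + y} ->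
  (forall m n, f (tens D m n) = g (tens D m n)) -> f =1 g.
Proof. by move=> fD gD fg; apply: tens_ind => // s t fs ft; rewrite fD gD fs ft. Qed.

End TensorTheory.

Lemma additive_comp (U V W : zmodType) (f : V -> W) (g : U -> V) :
  {morph f : x y / x + y} -> {morph g : x y / x + y} ->
  {morph f \o g : x y / x + y}.
Proof. by move=> fD gD x y /=; rewrite gD fD. Qed.

Lemma additive0 (U V : zmodType) (f : U -> V) :
  {morph f : x y / x + y} -> f 0 = 0.
Proof. by move=> fD; apply: (addrI (f 0)); rewrite -fD !addr0. Qed.

Section TensorMap.
Variables (E : nzRingType) (D : set E).

Definition tmap (M N M' N' : bimodType E) (f : M -> M') (g : N -> N') :
    tensor D M N -> tensor D M' N' :=
  tlift (fun m n => tens D (f m) (g n)).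

Definition tmapable (M N M' N' : bimodType E) (f : M -> M') (g : N -> N') :=
  [/\ {morph f : x y / x + y}, {morph g : x y / x + y},
      forall x d, D d -> f (x :* d) = f x :* d &
      forall y d, D d -> g (d *: y) = d *: g y].

Lemma tmap_balanced (M N M' N' : bimodType E) (f : M -> M') (g : N -> N') :
  tmapable f g -> balanced D (fun m n => tens D (f m) (g n)).
Proof.
case=> fD gD fS gS; split=> *.
- by rewrite fD tensDl.
- by rewrite gD tensDr.
- by rewrite fS // gS // tens_bal.
Qed.

Lemma tmap_tens (M N M' N' : bimodType E) (f : M -> M') (g : N -> N') m n :
  tmapable f g -> tmap f g (tens D m n) = tens D (f m) (g n).
Proof. by move=> h; rewrite /tmap tlift_tens //; apply: tmap_balanced. Qed.

Lemma tmapD (M N M' N' : bimodType E) (f : M -> M') (g : N -> N') :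
  tmapable f g -> {morph tmap f g : s t / s + t}.
Proof. by move=> h; apply: tliftD; apply: tmap_balanced. Qed.

End TensorMap.

Section TensorBimodule.
Variables (E : nzRingType) (D : set E) (M N : bimodType E).
Local Notation T := (tensor D M N).
Implicit Types (a b : E) (s t : T).

Definition tscalel a t : T := tmap (fun m => a *: m) id t.
Definition tscaler t a : T := tmap id (fun n => n :* a) t.

Lemma tmapable_scalel a : tmapable D (fun m : M => a *: m) (@id N).
Proof.
by split=> [x y|x y|x d _|y d _] //=; rewrite ?scalerDr ?scaler_rscale.
Qed.

Lemma tmapable_scaler a : tmapable D (@id M) (fun n : N => n :* a).
Proof.
by split=> [x y|x y|x d _|y d _] //=; rewrite ?rscalerDl ?scaler_rscale.
Qed.

Lemma tscalel_tens a m n : tscalel a (tens D m n) = tens D (a *: m) n.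
Proof. exact/tmap_tens/tmapable_scalel. Qed.

Lemma tscaler_tens a m n : tscaler (tens D m n) a = tens D m (n :* a).
Proof. exact/tmap_tens/tmapable_scaler. Qed.

Lemma tscalelDr a : {morph tscalel a : s t / s + t}.
Proof. exact/tmapD/tmapable_scalel. Qed.

Lemma tscalerDl : forall s t a, tscaler (s + t) a = tscaler s a + tscaler t a.
Proof. by move=> s t a; apply/tmapD/tmapable_scaler. Qed.

Lemma tscalelA a b t : tscalel a (tscalel b t) = tscalel (a * b) t.
Proof.
by elim/tens_ind: t => [m n|s t IHs IHt];
  rewrite ?tscalel_tens ?scalerA // !tscalelDr IHs IHt.
Qed.

Lemma tscalel1 : left_id 1 tscalel.
Proof.
by elim/tens_ind=> [m n|s t IHs IHt];
  rewrite ?tscalel_tens ?scale1r // !tscalelDr IHs IHt.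
Qed.

Lemma tscalelDl t : {morph tscalel^~ t : a b / a + b}.
Proof.
move=> a b; elim/tens_ind: t => [m n|s t IHs IHt].
  by rewrite !tscalel_tens scalerDl tensDl.
by rewrite !tscalelDr IHs IHt addrACA.
Qed.

HB.instance Definition _ := GRing.Zmodule_isLmodule.Build E T
  tscalelA tscalel1 tscalelDr tscalelDl.

Lemma tscalerA t a b : tscaler (tscaler t a) b = tscaler t (a * b).
Proof.
by elim/tens_ind: t => [m n|s t IHs IHt];
  rewrite ?tscaler_tens ?rscalerA // !tscalerDl IHs IHt.
Qed.

Lemma tscaler1 t : tscaler t 1 = t.
Proof.
by elim/tens_ind: t => [m n|s t IHs IHt];
  rewrite ?tscaler_tens ?rscaler1 // !tscalerDl IHs IHt.
Qed.

Lemma tscalerDr t a b : tscaler t (a + b) = tscaler t a + tscaler t b.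
Proof.
elim/tens_ind: t => [m n|s t IHs IHt].
  by rewrite !tscaler_tens rscalerDr tensDr.
by rewrite !tscalerDl IHs IHt addrACA.
Qed.

Lemma tscalel_scaler a t b : tscaler (a *: t) b = a *: tscaler t b.
Proof.
elim/tens_ind: t => [m n|s t IHs IHt].
  by rewrite /GRing.scale /= !(tscaler_tens, tscalel_tens).
by rewrite scalerDr !tscalerDl scalerDr IHs IHt.
Qed.

HB.instance Definition _ := Lmodule_isBimodule.Build E T
  tscalerA tscaler1 tscalerDl tscalerDr tscalel_scaler.

Lemma scale_tens a m n : a *: tens D m n = tens D (a *: m) n.
Proof. exact: tscalel_tens. Qed.

Lemma rscale_tens m n a : tens D m n :* a = tens D m (n :* a).
Proof. exact: tscaler_tens. Qed.

End TensorBimodule.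

Section Hom.
Variable E : nzRingType.
Implicit Types U V W : bimodType E.

Lemma bimod_homD U V (f : U -> V) : bimod_hom f -> {morph f : x y / x + y}.
Proof. by case=> fl _ x y; rewrite -[x]scale1r fl !scale1r. Qed.

Lemma bimod_homZ U V (f : U -> V) a x : bimod_hom f -> f (a *: x) = a *: f x.
Proof.
by move=> fh; rewrite -[a *: x]addr0 (proj1 fh) (additive0 (bimod_homD fh)) addr0.
Qed.

Lemma bimod_homR U V (f : U -> V) x a : bimod_hom f -> f (x :* a) = f x :* a.
Proof. by case=> _ ->. Qed.

Lemma bimod_hom_of U V (f : U -> V) : {morph f : x y / x + y} ->
  (forall a x, f (a *: x) = a *: f x) -> (forall x a, f (x :* a) = f x :* a) ->
  bimod_hom f.
Proof. by move=> fD fZ fR; split=> // a x y; rewrite fD fZ. Qed.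

Lemma bimod_hom_id U : bimod_hom (@id U).
Proof. by split. Qed.

Lemma bimod_hom_comp U V W (f : V -> W) (g : U -> V) :
  bimod_hom f -> bimod_hom g -> bimod_hom (f \o g).
Proof.
move=> fh gh; apply: bimod_hom_of => [|a x|x a] /=.
- exact: additive_comp (bimod_homD fh) (bimod_homD gh).
- by rewrite (bimod_homZ _ _ gh) (bimod_homZ _ _ fh).
- by rewrite (bimod_homR _ _ gh) (bimod_homR _ _ fh).
Qed.

Lemma bimod_homB U V (f : U -> V) : bimod_hom f -> {morph f : x y / x - y}.
Proof.
by move=> fh x y; rewrite (bimod_homD fh) -scaleN1r (bimod_homZ _ _ fh) scaleN1r.
Qed.

Lemma bimod_hom_tmapable (D : set E) (M N M' N' : bimodType E) (f : M -> M') (g : N -> N') :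
  bimod_hom f -> bimod_hom g -> tmapable D f g.
Proof.
move=> fh gh; split=> [||x d _|x d _]; try exact: bimod_homD.
  exact: bimod_homR.
exact: bimod_homZ.
Qed.

Lemma tlift_hom (D : set E) (M N V : bimodType E) (f : M -> N -> V) :
  balanced D f -> (forall a m n, f (a *: m) n = a *: f m n) ->
  (forall m n a, f m (n :* a) = f m n :* a) ->
  bimod_hom (tlift f : tensor D M N -> V).
Proof.
move=> fb fZ fR; apply: bimod_hom_of; first exact: tliftD.
- move=> a; elim/tens_ind=> [m n|s t IHs IHt].
    by rewrite scale_tens !tlift_tens.
  by rewrite scalerDr !tliftD // scalerDr IHs IHt.
- move=> t a; elim/tens_ind: t => [m n|s t IHs IHt].
    by rewrite rscale_tens !tlift_tens.
  by rewrite rscalerDl !tliftD // rscalerDl IHs IHt.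
Qed.

Lemma tmap_hom (D : set E) (M N M' N' : bimodType E) (f : M -> M') (g : N -> N') :
  bimod_hom f -> bimod_hom g -> bimod_hom (tmap f g : tensor D M N -> _).
Proof.
move=> fh gh; apply: tlift_hom => [|a m n|m n a].
- exact/tmap_balanced/bimod_hom_tmapable.
- by rewrite (bimod_homZ _ _ fh) scale_tens.
- by rewrite (bimod_homR _ _ gh) rscale_tens.
Qed.

Lemma tens_hom_ext (D : set E) (M N V : bimodType E) (f g : tensor D M N -> V) :
  bimod_hom f -> bimod_hom g ->
  (forall m n, f (tens D m n) = g (tens D m n)) -> f =1 g.
Proof. by move=> fh gh; apply: tens_ext; apply: bimod_homD. Qed.

Lemma tmap_comp (D : set E) (M N M' N' M'' N'' : bimodType E)
    (f : M -> M') (g : N -> N') (f' : M' -> M'') (g' : N' -> N'') t :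
  bimod_hom f -> bimod_hom g -> bimod_hom f' -> bimod_hom g' ->
  tmap f' g' (tmap f g t : tensor D _ _) = tmap (f' \o f) (g' \o g) t.
Proof.
move=> fh gh fh' gh'; move: t; apply: tens_hom_ext => [||m n].
- by apply: (@bimod_hom_comp _ _ _ (tmap f' g') (tmap f g)); apply: tmap_hom.
- by apply: tmap_hom; apply: bimod_hom_comp.
- rewrite !tmap_tens //; try exact: bimod_hom_tmapable.
  by apply: bimod_hom_tmapable; apply: bimod_hom_comp.
Qed.

Definition tassoc (L M N : bimodType E) :
    tensor setT (tensor setT L M) N -> tensor setT L (tensor setT M N) :=
  tlift (fun s n => tlift (fun l m => tens setT l (tens setT m n)) s).
Arguments tassoc {L M N}.

Lemma tassoc_balanced_in (L M N : bimodType E) (n : N) :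
  balanced setT (fun (l : L) (m : M) => tens setT l (tens setT m n)).
Proof.
split=> [l l' m|l m m'|l d m _]; rewrite ?tensDl ?tensDr ?tensDl ?tensDr //.
by rewrite tens_bal // scale_tens.
Qed.

Lemma tassoc_balanced (L M N : bimodType E) :
  balanced setT (fun (s : tensor setT L M) (n : N) =>
    tlift (fun l m => tens setT l (tens setT m n)) s).
Proof.
split=> [s s' n|s n n'|s d n _].
- by rewrite tliftD //; apply: tassoc_balanced_in.
- elim/tens_ind: s => [l m|s t IHs IHt].
    by rewrite !tlift_tens ?tensDr //; apply: tassoc_balanced_in.
  rewrite !tliftD; try exact: tassoc_balanced_in.
  by rewrite IHs IHt addrACA.
- elim/tens_ind: s => [l m|s t IHs IHt].
    rewrite rscale_tens !tlift_tens; try exact: tassoc_balanced_in.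
    by rewrite tens_bal.
  rewrite rscalerDl !tliftD; try exact: tassoc_balanced_in.
  by rewrite IHs IHt.
Qed.

Lemma tassoc_tens (L M N : bimodType E) (l : L) (m : M) (n : N) :
  tassoc (tens setT (tens setT l m) n) = tens setT l (tens setT m n).
Proof.
rewrite /tassoc tlift_tens ?tlift_tens //; first exact: tassoc_balanced_in.
exact: tassoc_balanced.
Qed.

Lemma tassoc_hom (L M N : bimodType E) : bimod_hom (@tassoc L M N).
Proof.
apply: tlift_hom => [|a s n|s n a]; first exact: tassoc_balanced.
- elim/tens_ind: s => [l m|s t IHs IHt].
    rewrite scale_tens !tlift_tens; try exact: tassoc_balanced_in.
    by rewrite scale_tens.
  rewrite scalerDr !tliftD; try exact: tassoc_balanced_in.
  by rewrite scalerDr IHs IHt.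
- elim/tens_ind: s => [l m|s t IHs IHt].
    rewrite !tlift_tens; try exact: tassoc_balanced_in.
    by rewrite !rscale_tens.
  rewrite !tliftD; try exact: tassoc_balanced_in.
  by rewrite rscalerDl IHs IHt.
Qed.

Lemma tens3_hom_ext (L M N V : bimodType E)
    (f g : tensor setT (tensor setT L M) N -> V) :
  bimod_hom f -> bimod_hom g ->
  (forall l m n, f (tens setT (tens setT l m) n) = g (tens setT (tens setT l m) n)) ->
  f =1 g.
Proof.
move=> fh gh fg; apply: tens_hom_ext => // s n.
elim/tens_ind: s => [//|s t IHs IHt].
by rewrite tensDl (bimod_homD fh) (bimod_homD gh) IHs IHt.
Qed.

Lemma tassoc_nat (L M N L' M' N' : bimodType E)
    (f : L -> L') (g : M -> M') (h : N -> N') t :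
  bimod_hom f -> bimod_hom g -> bimod_hom h ->
  tassoc (tmap (tmap f g) h t) = tmap f (tmap g h) (tassoc t).
Proof.
move=> fh gh hh.
have ? : bimod_hom (tmap f g : tensor setT _ _ -> _) by apply: tmap_hom.
have ? : bimod_hom (tmap g h : tensor setT _ _ -> _) by apply: tmap_hom.
move: t; apply: tens3_hom_ext => [||l m n].
- by apply: bimod_hom_comp (tassoc_hom _ _ _) _; apply: tmap_hom.
- by apply: bimod_hom_comp _ (tassoc_hom _ _ _); apply: tmap_hom.
- by rewrite !(tmap_tens, tassoc_tens) //; apply: bimod_hom_tmapable.
Qed.

End Hom.
Arguments tassoc {E L M N}.

Record coring (E : nzRingType) := Coring {
  coring_bimod :> bimodType E;
  comul : coring_bimod -> tensor setT coring_bimod coring_bimod;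
  counit : coring_bimod -> E^o;
  comul_hom : bimod_hom comul;
  counit_hom : bimod_hom counit;
  coassoc : forall c,
    tassoc (tmap comul id (comul c)) = tmap id comul (comul c);
  counitl : forall c, tlift (fun x y : coring_bimod => (counit x : E) *: y) (comul c) = c;
  counitr : forall c, tlift (fun x y : coring_bimod => x :* (counit y : E)) (comul c) = c
}.

Section CoringHom.
Variable E : nzRingType.

Definition coring_hom (C C' : coring E) (f : C -> C') : Prop :=
  [/\ bimod_hom f, forall c, comul (f c) = tmap f f (comul c) &
      forall c, counit (f c) = counit c].

Definition coring_iso (C C' : coring E) : Prop :=
  exists (f : C -> C') (g : C' -> C),
    [/\ coring_hom f, coring_hom g, cancel f g & cancel g f].

End CoringHom.

Lemma regular_scale1 (E : nzRingType) (a : E^o) : (a : E) *: (1 : E^o) = a.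
Proof. exact: mulr1. Qed.

Lemma regular_rscale1 (E : nzRingType) (a : E^o) : (1 : E^o) :* (a : E) = a.
Proof. exact: mul1r. Qed.

Section Sweedler.
Variables (E : nzRingType) (D : set E).
Local Notation S := (tensor D E^o E^o : bimodType E).

Definition sweedler_comul : S -> tensor setT S S :=
  tlift (fun x y : E^o => tens setT (tens D x (1 : E^o)) (tens D (1 : E^o) y)).

Definition sweedler_counit : S -> E^o :=
  tlift (fun x y : E^o => (x : E) * y : E^o).

Lemma sweedler_comul_balanced :
  balanced D (fun x y : E^o =>
    tens setT (tens D x (1 : E^o)) (tens D (1 : E^o) y)).
Proof.
split=> [x x' y|x y y'|x d y Dd]; rewrite ?tensDl ?tensDr //.
rewrite tens_bal // (regular_scale1 (d : E^o)).
rewrite -{1}(regular_rscale1 (d : E^o)) -rscale_tens tens_bal //.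
rewrite scale_tens regular_scale1 -{1}(regular_rscale1 (d : E^o)).
by rewrite tens_bal.
Qed.

Lemma sweedler_counit_balanced :
  balanced D (fun x y : E^o => (x : E) * y : E^o).
Proof.
split=> [x x' y|x y y'|x d y Dd]; rewrite ?mulrDl ?mulrDr //.
by rewrite -[x :* d]/((x : E) * d) -[d *: y]/(d * (y : E)) mulrA.
Qed.

Lemma sweedler_comul_tens x y :
  sweedler_comul (tens D x y) =
  tens setT (tens D x (1 : E^o)) (tens D (1 : E^o) y).
Proof. exact/tlift_tens/sweedler_comul_balanced. Qed.

Lemma sweedler_counit_tens x y : sweedler_counit (tens D x y) = (x : E) * y.
Proof. exact/tlift_tens/sweedler_counit_balanced. Qed.

Lemma sweedler_comul_hom : bimod_hom sweedler_comul.
Proof.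
apply: tlift_hom => [|a x y|x y a]; first exact: sweedler_comul_balanced.
  by rewrite !scale_tens.
by rewrite !rscale_tens.
Qed.

Lemma sweedler_counit_hom : bimod_hom sweedler_counit.
Proof.
apply: tlift_hom => [|a x y|x y a]; first exact: sweedler_counit_balanced.
  by rewrite -[a *: x]/(a * (x : E)) -mulrA.
by rewrite -[y :* a]/((y : E) * a) mulrA.
Qed.

Lemma sweedler_coassoc c :
  tassoc (tmap sweedler_comul id (sweedler_comul c)) =
  tmap id sweedler_comul (sweedler_comul c).
Proof.
have hD := sweedler_comul_hom; have hI := @bimod_hom_id E S.
move: c; apply: tens_hom_ext => [||x y].
- apply: (@bimod_hom_comp _ _ _ _ tassoc (tmap _ id \o _)) (tassoc_hom _ _ _) _.
  apply: (@bimod_hom_comp _ _ _ _ (tmap _ id) _ _ hD).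
  by apply: tmap_hom; [exact: hD|exact: hI].
- apply: (@bimod_hom_comp _ _ _ _ (tmap id _) _ _ hD).
  by apply: tmap_hom; [exact: hI|exact: hD].
- rewrite sweedler_comul_tens !tmap_tens; try exact: bimod_hom_tmapable.
  by rewrite !sweedler_comul_tens tassoc_tens.
Qed.

Lemma counitl_balanced (M : bimodType E) (f : M -> E^o) : bimod_hom f ->
  balanced setT (fun x y : M => (f x : E) *: y).
Proof.
move=> fh; split=> [x x' y|x y y'|x d y _].
- by rewrite (bimod_homD fh) scalerDl.
- by rewrite scalerDr.
- by rewrite (bimod_homR _ _ fh) scalerA.
Qed.

Lemma counitr_balanced (M : bimodType E) (f : M -> E^o) : bimod_hom f ->
  balanced setT (fun x y : M => x :* (f y : E)).
Proof.
move=> fh; split=> [x x' y|x y y'|x d y _].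
- by rewrite rscalerDl.
- by rewrite (bimod_homD fh) rscalerDr.
- by rewrite (bimod_homZ _ _ fh) rscalerA.
Qed.

Lemma counitl_lift_hom (M : bimodType E) (f : M -> E^o) : bimod_hom f ->
  bimod_hom (tlift (fun x y : M => (f x : E) *: y) : tensor setT M M -> M).
Proof.
move=> fh; apply: tlift_hom => [|a x y|x y a]; first exact: counitl_balanced.
  by rewrite (bimod_homZ _ _ fh) scalerA.
by rewrite scaler_rscale.
Qed.

Lemma counitr_lift_hom (M : bimodType E) (f : M -> E^o) : bimod_hom f ->
  bimod_hom (tlift (fun x y : M => x :* (f y : E)) : tensor setT M M -> M).
Proof.
move=> fh; apply: tlift_hom => [|a x y|x y a]; first exact: counitr_balanced.
  by rewrite scaler_rscale.
by rewrite (bimod_homR _ _ fh) rscalerA.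
Qed.

Lemma sweedler_counitl c :
  tlift (fun x y : S => (sweedler_counit x : E) *: y) (sweedler_comul c) = c.
Proof.
have hE := sweedler_counit_hom; move: c; apply: tens_hom_ext => [||x y].
- exact: bimod_hom_comp (counitl_lift_hom hE) sweedler_comul_hom.
- exact: bimod_hom_id.
- rewrite sweedler_comul_tens tlift_tens; last exact: counitl_balanced.
  rewrite sweedler_counit_tens mulr1 scale_tens.
  by rewrite regular_scale1.
Qed.

Lemma sweedler_counitr c :
  tlift (fun x y : S => x :* (sweedler_counit y : E)) (sweedler_comul c) = c.
Proof.
have hE := sweedler_counit_hom; move: c; apply: tens_hom_ext => [||x y].
- exact: bimod_hom_comp (counitr_lift_hom hE) sweedler_comul_hom.
- exact: bimod_hom_id.
- rewrite sweedler_comul_tens tlift_tens; last exact: counitr_balanced.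
  rewrite sweedler_counit_tens mul1r rscale_tens.
  by rewrite regular_rscale1.
Qed.

Definition sweedler : coring E :=
  Coring sweedler_comul_hom sweedler_counit_hom sweedler_coassoc
    sweedler_counitl sweedler_counitr.

Definition sweedler_grouplike : sweedler := tens D (1 : E^o) (1 : E^o).

End Sweedler.

Section Coideal.
Variables (E : nzRingType) (C : coring E).

Record coideal := Coideal {
  coideal_set :> set C;
  coidealP : exists (B : coring E) (f : C -> B),
    [/\ coring_hom f, forall b, exists c, f c = b & coideal_set = [set c | f c = 0]]
}.

Lemma coideal_inj (J J' : coideal) : J = J' :> set C -> J = J'.
Proof.
by case: J J' => J hJ [J' hJ'] /= e; subst J'; congr Coideal; apply: Prop_irrelevance.
Qed.

Variable J : coideal.

Lemma coideal_zmod_closed : zmod_closed [in (J : set C)].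
Proof.
have [B [f [[fh _ _] _ ->]]] := coidealP J.
split; first by apply/mem_set/additive0/bimod_homD.
move=> x y; rewrite !inE /= => x0 y0.
by rewrite (bimod_homB fh) x0 y0 subrr.
Qed.

Lemma coidealZ a x : coideal_set J x -> coideal_set J (a *: x).
Proof.
have [B [f [[fh _ _] _ ->]]] := coidealP J; rewrite /= => x0.
by rewrite (bimod_homZ _ _ fh) x0 scaler0.
Qed.

Lemma coidealR x a : coideal_set J x -> coideal_set J (x :* a).
Proof.
have [B [f [[fh _ _] _ ->]]] := coidealP J; rewrite /= => x0.
rewrite (bimod_homR _ _ fh) x0.
by apply: (addrI (0 :* a)); rewrite -rscalerDl !addr0.
Qed.

Definition coideal_pred : C -> bool := [in (J : set C)].

HB.instance Definition _ :=
  GRing.isZmodClosed.Build C coideal_pred coideal_zmod_closed.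

Definition coideal_subgroup : zmodClosed C :=
  GRing.ZmodClosed.clone C coideal_pred _.

Definition quot_sort : Type := Quotient.quot coideal_subgroup.

HB.instance Definition _ := GRing.Zmodule.on quot_sort.

Local Notation Q := (Quotient.quot coideal_subgroup).

Definition quot_proj (c : C) : quot_sort := \pi_Q c.
Definition quot_repr (q : quot_sort) : C := repr (q : Q).

Lemma quot_reprK q : quot_proj (quot_repr q) = q.
Proof. exact: reprK. Qed.

Lemma quot_projP x y : quot_proj x = quot_proj y <-> coideal_set J (x - y).
Proof.
rewrite /quot_proj; split.
  by move/eqP; rewrite -Quotient.idealrBE => /set_mem.
by move=> h; apply/eqP; rewrite -Quotient.idealrBE; apply/mem_set.
Qed.

Lemma quot_projD : {morph quot_proj : x y / x + y}.
Proof. by move=> x y; exact: (raddfD (\pi_Q)). Qed.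

Lemma quot_ind (P : quot_sort -> Prop) : (forall c, P (quot_proj c)) -> forall q, P q.
Proof. by move=> h q; rewrite -(quot_reprK q). Qed.

Definition quot_scale a (q : quot_sort) : quot_sort := quot_proj (a *: quot_repr q).
Definition quot_rscale (q : quot_sort) a : quot_sort := quot_proj (quot_repr q :* a).

Lemma quot_repr_proj c : coideal_set J (quot_repr (quot_proj c) - c).
Proof. exact/quot_projP/quot_reprK. Qed.

Lemma quot_scale_proj a c : quot_scale a (quot_proj c) = quot_proj (a *: c).
Proof.
by apply/quot_projP; rewrite -scalerBr; apply/coidealZ/quot_repr_proj.
Qed.

Lemma quot_rscale_proj c a : quot_rscale (quot_proj c) a = quot_proj (c :* a).
Proof.
apply/quot_projP.
have -> : quot_repr (quot_proj c) :* a - c :* a =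
          (quot_repr (quot_proj c) - c) :* a.
  by apply: (addIr (c :* a)); rewrite subrK -rscalerDl subrK.
exact/coidealR/quot_repr_proj.
Qed.

Lemma quot_scaleA a b q : quot_scale a (quot_scale b q) = quot_scale (a * b) q.
Proof. by elim/quot_ind: q => c; rewrite !quot_scale_proj scalerA. Qed.

Lemma quot_scale1 : left_id 1 quot_scale.
Proof. by elim/quot_ind=> c; rewrite quot_scale_proj scale1r. Qed.

Lemma quot_scaleDr : right_distributive quot_scale +%R.
Proof.
move=> a; elim/quot_ind=> c; elim/quot_ind=> d.
by rewrite -quot_projD !quot_scale_proj scalerDr quot_projD.
Qed.

Lemma quot_scaleDl q : {morph quot_scale^~ q : a b / a + b}.
Proof.
by move=> a b; elim/quot_ind: q => c; rewrite !quot_scale_proj scalerDl quot_projD.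
Qed.

HB.instance Definition _ := GRing.Zmodule_isLmodule.Build E quot_sort
  quot_scaleA quot_scale1 quot_scaleDr quot_scaleDl.

Lemma quot_rscaleA q a b : quot_rscale (quot_rscale q a) b = quot_rscale q (a * b).
Proof. by elim/quot_ind: q => c; rewrite !quot_rscale_proj rscalerA. Qed.

Lemma quot_rscale1 q : quot_rscale q 1 = q.
Proof. by elim/quot_ind: q => c; rewrite quot_rscale_proj rscaler1. Qed.

Lemma quot_rscaleDl p q a :
  quot_rscale (p + q) a = quot_rscale p a + quot_rscale q a.
Proof.
elim/quot_ind: p => c; elim/quot_ind: q => d.
by rewrite -quot_projD !quot_rscale_proj rscalerDl quot_projD.
Qed.

Lemma quot_rscaleDr q a b :
  quot_rscale q (a + b) = quot_rscale q a + quot_rscale q b.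
Proof.
by elim/quot_ind: q => c; rewrite !quot_rscale_proj rscalerDr quot_projD.
Qed.

Lemma quot_scale_rscale a q b : quot_rscale (a *: q) b = a *: quot_rscale q b.
Proof.
elim/quot_ind: q => c; rewrite /GRing.scale /=.
by rewrite !(quot_scale_proj, quot_rscale_proj) scaler_rscale.
Qed.

HB.instance Definition _ := Lmodule_isBimodule.Build E quot_sort
  quot_rscaleA quot_rscale1 quot_rscaleDl quot_rscaleDr quot_scale_rscale.

Lemma quot_proj_hom : bimod_hom quot_proj.
Proof.
apply: bimod_hom_of => [|a c|c a]; first exact: quot_projD.
  by rewrite -quot_scale_proj.
by rewrite -quot_rscale_proj.
Qed.

(* The choice of representatives is immaterial, by [quot_comul_proj] and
   [quot_counit_proj]: these are the only maps on [C / J] that make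
   [quot_proj] a coring homomorphism. *)
Definition quot_comul (q : quot_sort) : tensor setT quot_sort quot_sort :=
  tmap quot_proj quot_proj (comul (quot_repr q)).

Definition quot_counit (q : quot_sort) : E^o := counit (quot_repr q).

Lemma coideal_comul c : coideal_set J c -> tmap quot_proj quot_proj (comul c) = 0 :> tensor setT _ _.
Proof.
have [B [f [[fh fC _] fs defJ]]] := coidealP J.
rewrite defJ /= => fc0.
have /choice[s0 s0P] := fs.
pose s b := quot_proj (s0 b).
have sf x : s (f x) = quot_proj x.
  by apply/quot_projP; rewrite defJ /= (bimod_homB fh) s0P subrr.
have sh : bimod_hom s.
  have hp := quot_proj_hom; apply: bimod_hom_of.
  - move=> b b'; have [x <-] := fs b; have [x' <-] := fs b'.
    by rewrite -(bimod_homD fh) (sf x) (sf x') sf; exact: quot_projD.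
  - move=> a b; have [x <-] := fs b.
    by rewrite -(bimod_homZ _ _ fh) (sf x) sf; exact: (bimod_homZ _ _ hp).
  - move=> b a; have [x <-] := fs b.
    by rewrite -(bimod_homR _ _ fh) (sf x) sf; exact: (bimod_homR _ _ hp).
have -> : quot_proj = s \o f by apply/funext => x /=; rewrite sf.
rewrite -tmap_comp // -fC fc0.
have -> : comul (0 : B) = 0 by exact: additive0 (bimod_homD (comul_hom B)).
apply: additive0; apply: bimod_homD; exact: tmap_hom.
Qed.

Lemma quot_comul_proj c : quot_comul (quot_proj c) = tmap quot_proj quot_proj (comul c).
Proof.
have hp := quot_proj_hom.
have h : bimod_hom (tmap quot_proj quot_proj \o @comul _ C).
  by apply: bimod_hom_comp _ (comul_hom C); apply: tmap_hom.
apply/eqP; rewrite -subr_eq0; apply/eqP.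
rewrite -[LHS](bimod_homB h) /=.
exact/coideal_comul/quot_repr_proj.
Qed.

Lemma quot_counit_proj c : quot_counit (quot_proj c) = counit c.
Proof.
have [B [f [[fh _ fe] _ defJ]]] := coidealP J.
apply/eqP; rewrite -subr_eq0 -(bimod_homB (counit_hom C)) -fe; apply/eqP.
have := quot_repr_proj c; rewrite {1}defJ /= => ->.
exact: additive0 (bimod_homD (counit_hom B)).
Qed.

Lemma quot_comul_hom : bimod_hom quot_comul.
Proof.
have hp := quot_proj_hom.
have h : bimod_hom (tmap quot_proj quot_proj \o @comul _ C).
  by apply: bimod_hom_comp _ (comul_hom C); apply: tmap_hom.
apply: bimod_hom_of => [p q|a q|q a].
- elim/quot_ind: p => c; elim/quot_ind: q => d; rewrite -(bimod_homD hp).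
  by rewrite !quot_comul_proj; exact: (bimod_homD h).
- elim/quot_ind: q => c; rewrite -(bimod_homZ _ _ hp) !quot_comul_proj.
  exact: (bimod_homZ _ _ h).
- elim/quot_ind: q => c; rewrite -(bimod_homR _ _ hp) !quot_comul_proj.
  exact: (bimod_homR _ _ h).
Qed.

Lemma quot_counit_hom : bimod_hom quot_counit.
Proof.
have hp := quot_proj_hom; have h := counit_hom C.
apply: bimod_hom_of => [p q|a q|q a].
- elim/quot_ind: p => c; elim/quot_ind: q => d; rewrite -(bimod_homD hp).
  by rewrite !quot_counit_proj (bimod_homD h).
- elim/quot_ind: q => c; rewrite -(bimod_homZ _ _ hp) !quot_counit_proj.
  exact: (bimod_homZ _ _ h).
- elim/quot_ind: q => c; rewrite -(bimod_homR _ _ hp) !quot_counit_proj.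
  exact: (bimod_homR _ _ h).
Qed.

Lemma quot_coassoc q :
  tassoc (tmap quot_comul id (quot_comul q)) =
  tmap id quot_comul (quot_comul q).
Proof.
have hp := quot_proj_hom; have hD := comul_hom C; have hq := quot_comul_hom.
have hI := @bimod_hom_id E C; have hI' := @bimod_hom_id E quot_sort.
have hpp : bimod_hom (tmap quot_proj quot_proj : tensor setT C C -> _).
  exact: tmap_hom.
elim/quot_ind: q => c; rewrite !quot_comul_proj !tmap_comp //.
have -> : quot_comul \o quot_proj = tmap quot_proj quot_proj \o @comul _ C.
  by apply/funext => x /=; rewrite quot_comul_proj.
rewrite -[id \o quot_proj]/(quot_proj \o id).
by rewrite -!tmap_comp // tassoc_nat // coassoc.
Qed.

Lemma quot_counitl q : tlift (fun x y : quot_sort => (quot_counit x : E) *: y) (quot_comul q) = q.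
Proof.
have hp := quot_proj_hom; have he := counit_hom C; have hq := quot_counit_hom.
elim/quot_ind: q => c; rewrite quot_comul_proj -{2}[c]counitl.
move: (comul c); apply: tens_hom_ext => [||x y].
- by apply: bimod_hom_comp (counitl_lift_hom hq) _; apply: tmap_hom.
- exact: bimod_hom_comp hp (counitl_lift_hom he).
- rewrite tmap_tens; last exact: bimod_hom_tmapable.
  rewrite !tlift_tens; try exact: counitl_balanced.
  by rewrite quot_counit_proj (bimod_homZ _ _ hp).
Qed.

Lemma quot_counitr q : tlift (fun x y : quot_sort => x :* (quot_counit y : E)) (quot_comul q) = q.
Proof.
have hp := quot_proj_hom; have he := counit_hom C; have hq := quot_counit_hom.
elim/quot_ind: q => c; rewrite quot_comul_proj -{2}[c]counitr.
move: (comul c); apply: tens_hom_ext => [||x y].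
- by apply: bimod_hom_comp (counitr_lift_hom hq) _; apply: tmap_hom.
- exact: bimod_hom_comp hp (counitr_lift_hom he).
- rewrite tmap_tens; last exact: bimod_hom_tmapable.
  rewrite !tlift_tens; try exact: counitr_balanced.
  by rewrite quot_counit_proj (bimod_homR _ _ hp).
Qed.

Definition quot_coring : coring E :=
  Coring quot_comul_hom quot_counit_hom quot_coassoc quot_counitl quot_counitr.

Lemma quot_proj_coring_hom : coring_hom (quot_proj : C -> quot_coring).
Proof.
split; [exact: quot_proj_hom|exact: quot_comul_proj|exact: quot_counit_proj].
Qed.

End Coideal.

Section SweedlerMap.
Variables (E : nzRingType) (D C : set E).
Hypothesis sDC : D `<=` C.

Definition sweedler_map : sweedler D -> sweedler C :=
  tlift (fun x y : E^o => tens C x y).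

Lemma sweedler_map_balanced : balanced D (fun x y : E^o => tens C x y).
Proof.
split=> [x x' y|x y y'|x d y /sDC Cd]; first exact: tensDl.
  exact: tensDr.
exact: tens_bal.
Qed.

Lemma sweedler_map_tens x y : sweedler_map (tens D x y) = tens C x y.
Proof. exact/tlift_tens/sweedler_map_balanced. Qed.

Lemma sweedler_map_hom : bimod_hom sweedler_map.
Proof.
apply: tlift_hom => [|a x y|x y a]; first exact: sweedler_map_balanced.
  exact/esym/scale_tens.
exact/esym/rscale_tens.
Qed.

Lemma sweedler_map_coring_hom : coring_hom sweedler_map.
Proof.
have h := sweedler_map_hom; split=> //.
- apply: tens_hom_ext => [||x y].
  + exact: (@bimod_hom_comp _ _ _ _ (@comul _ (sweedler C)) _ (comul_hom _) h).
  + apply: (@bimod_hom_comp _ _ _ _ (tmap _ _) _ _ (comul_hom (sweedler D))).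
    by apply: tmap_hom; exact: h.
  + rewrite sweedler_map_tens /= !sweedler_comul_tens.
    rewrite tmap_tens; last exact: (bimod_hom_tmapable _ h h).
    by rewrite !sweedler_map_tens.
- apply: tens_hom_ext => [||x y].
  + exact: (@bimod_hom_comp _ _ _ _ (@counit _ (sweedler C)) _ (counit_hom _) h).
  + exact: counit_hom (sweedler D).
  + by rewrite sweedler_map_tens /= !sweedler_counit_tens.
Qed.

Lemma sweedler_map_surj t : exists s, sweedler_map s = t.
Proof.
elim/tens_ind: t => [x y|s t [s' <-] [t' <-]].
  by exists (tens D x y); rewrite sweedler_map_tens.
by exists (s' + t'); rewrite (bimod_homD sweedler_map_hom).
Qed.

Lemma sweedler_coidealP : exists (B : coring E) (f : sweedler D -> B),
  [/\ coring_hom f, forall b, exists c, f c = b &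
      [set c | sweedler_map c = 0] = [set c | f c = 0]].
Proof.
exists (sweedler C), sweedler_map.
split=> //; [exact: sweedler_map_coring_hom|exact: sweedler_map_surj].
Qed.

Definition sweedler_coideal : coideal (sweedler D) :=
  Coideal sweedler_coidealP.

End SweedlerMap.

Section Correspondence.
Variable E : unitRingType.

(* [divring_closed] asks for closure under [x / y] for all [x] and [y]; this
   includes [y = 0], where [0^-1 = 0]. *)
Record divsubring := Divsubring {
  divsubring_set :> set E;
  divsubring_closed : divring_closed [in divsubring_set]
}.

Record intermediate (D : divsubring) := Intermediate {
  intermediate_ring :> divsubring;
  intermediate_sub : (D : set E) `<=` intermediate_ring
}.

Lemma intermediate_inj (D : divsubring) (C C' : intermediate D) :
  C = C' :> set E -> C = C'.
Proof.
case: C C' => [[C hC] sC] [[C' hC'] sC'] /= e; subst C'.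
have e : hC = hC' by exact: Prop_irrelevance.
by subst hC'; congr Intermediate; apply: Prop_irrelevance.
Qed.

Definition conjugated (C C' : set E) : Prop :=
  exists2 u : E, u \is a GRing.unit & C' = [set u * c * u^-1 | c in C].

Variable D : divsubring.

Definition commutant (J : coideal (sweedler D)) : set E :=
  let g := quot_proj J (sweedler_grouplike D) in [set e | e *: g = g :* e].

Lemma commutant_divring J : divring_closed [in commutant J].
Proof.
rewrite /commutant; set g := quot_proj J _; split=> [|x y|x y].
- by apply/mem_set; rewrite /= scale1r rscaler1.
- rewrite !inE /= => xg yg; rewrite scalerBl xg yg.
  by apply: (addIr (g :* y)); rewrite subrK -rscalerDr subrK.
- rewrite !inE /= => xg yg.
  have Vg : y^-1 *: g = g :* y^-1.
    have [uy|nuy] := boolP (y \is a GRing.unit); last by rewrite invr_out.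
    rewrite -[g in LHS]rscaler1 -(divrr uy) -rscalerA -yg.
    by rewrite scaler_rscale scalerA mulVr // scale1r.
  by rewrite -scalerA Vg -scaler_rscale xg rscalerA.
Qed.

Lemma commutant_sub J : (D : set E) `<=` commutant J.
Proof.
move=> d Dd; rewrite /commutant /=.
rewrite -(bimod_homZ _ _ (quot_proj_hom J)) -(bimod_homR _ _ (quot_proj_hom J)).
congr quot_proj; rewrite /sweedler_grouplike.
transitivity (tens D (d : E^o) (1 : E^o)).
  by rewrite -{2}(regular_scale1 (d : E^o)); exact: scale_tens.
transitivity (tens D (1 : E^o) (d : E^o)); last first.
  by rewrite -{1}(regular_rscale1 (d : E^o)); exact/esym/rscale_tens.
rewrite -{1}(regular_rscale1 (d : E^o)) tens_bal //.
by congr tens; exact: regular_scale1.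
Qed.

Definition ring_of_coideal (J : coideal (sweedler D)) : intermediate D :=
  @Intermediate D (Divsubring (commutant_divring J)) (@commutant_sub J).

Definition coideal_of_ring (C : intermediate D) : coideal (sweedler D) :=
  sweedler_coideal (@intermediate_sub D C).

End Correspondence.

(* Main.v *)
(* For a group-like element [g] of an [E]-coring over a division ring, with
   commutant [C], the map [x (x)_C y |-> x g y] is injective. Take a shortest
   relation [\sum_i x_i g y_i = 0] with some coefficient [1]; applying the
   comultiplication shows that every [x_i g - g x_i] vanishes, so all [x_i] lie
   in [C], and the counit gives [\sum_i x_i y_i = 0]. With [g] the image of
   [1 (x) 1] in the quotient by a coideal [J], this says that [J] is the kernel
   of [E (x)_D E -> E (x)_C E]. Conversely [C]-linear forms [E -> C] separate
   [e (x) 1] from [1 (x) e] when [e] is not in [C].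
   Contracting [\Delta h = h (x) h] with such a form shows that every group-like
   [h] of [E (x)_C E] is [a (1 (x) 1) a^-1] for some [a], with commutant
   [a C a^-1]; hence isomorphic corings come from conjugated subrings. *)
Require Import Defs.
From mathcomp Require Import boolp classical_sets.
From mathcomp Require Import all_boot all_algebra.

Import GRing.Theory.
Local Open Scope ring_scope.

Set Implicit Arguments.
Unset Strict Implicit.

(** * Linear forms over a division subring *)

Section DivisionSubring.
Local Open Scope classical_set_scope.
Variable E : unitRingType.
Hypothesis hE : forall x : E, x != 0 -> x \is a GRing.unit.
Variable C : set E.
Hypothesis hC : GRing.divring_closed [in C].

Lemma divring1 : C 1.
Proof. by case: hC => /set_mem. Qed.

Lemma divringB x y : C x -> C y -> C (x - y).
Proof. by move=> Cx Cy; apply: set_mem; case: hC => _ + _; apply; apply: mem_set. Qed.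

Lemma divringF x y : C x -> C y -> C (x / y).
Proof. by move=> Cx Cy; apply: set_mem; case: hC => _ _; apply; apply: mem_set. Qed.

Lemma divring0 : C 0.
Proof. by rewrite -(subrr 1); apply: divringB divring1 divring1. Qed.

Lemma divringN x : C x -> C (- x).
Proof. by move=> Cx; rewrite -sub0r; apply: divringB divring0 Cx. Qed.

Lemma divringD x y : C x -> C y -> C (x + y).
Proof. by move=> Cx /divringN Cy; rewrite -[y]opprK; apply: divringB. Qed.

Lemma divringV x : C x -> C x^-1.
Proof. by move=> Cx; rewrite -div1r; apply: divringF divring1 Cx. Qed.

Lemma divringM x y : C x -> C y -> C (x * y).
Proof. by move=> Cx /divringV Cy; rewrite -[y]invrK; apply: divringF. Qed.

(** Linear algebra over [C] takes place on [E]-modules, with scalars restricted by the condition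
    [C c]; the choice [C := setT] gives [E]-linear algebra. A [functional] is thus a left [C]-linear
    form with values in [C]. *)
Definition subspace (V : lmodType E) (W : set V) :=
  [/\ W 0, forall x y, W x -> W y -> W (x + y) &
      forall c x, C c -> W x -> W (c *: x)].

Definition functional (V : lmodType E) (phi : V -> E) :=
  [/\ {morph phi : x y / x + y}, forall c x, C c -> phi (c *: x) = c * phi x &
      forall x, C (phi x)].

Lemma subspaceB (V : lmodType E) (W : set V) x y :
  subspace W -> W x -> W y -> W (x - y).
Proof.
case=> _ WD WZ Wx Wy; rewrite -scaleN1r; apply: WD => //; apply: WZ => //.
exact/divringN/divring1.
Qed.

(* A maximal subspace avoiding [v] is a hyperplane. *)
Lemma separating_hyperplane (V : lmodType E) (W : set V) v :
  subspace W -> ~ W v ->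
  exists H, [/\ subspace H, W `<=` H, ~ H v &
    forall x, exists2 c, C c & H (x - c *: v)].
Proof.
move=> sW nWv.
(* The premise makes [P] hold of the empty set, which is the union of the empty chain. *)
pose P X := X !=set0 -> [/\ subspace X, W `<=` X & ~ X v].
have [F FP Ftot|H [PH Hmax]] := @Zorn_bigcup V P.
  case=> x [X FX Xx]; have [sX WX _] := FP _ FX (ex_intro _ _ Xx).
  split; last by case=> Y FY Yv; case: (FP _ FY (ex_intro _ _ Yv)).
    split; first by exists X => //; apply: WX; case: sW.
      move=> y z [Y FY Yy] [Z FZ Zz].
      case: (Ftot _ _ FY FZ) => [/(_ _ Yy) Zy|/(_ _ Zz) Yz].
        by exists Z => //; case: (FP _ FZ (ex_intro _ _ Zz)) => -[_ ZD _] _ _; apply: ZD.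
      by exists Y => //; case: (FP _ FY (ex_intro _ _ Yy)) => -[_ YD _] _ _; apply: YD.
    move=> c y Cc [Y FY Yy]; exists Y => //.
    by case: (FP _ FY (ex_intro _ _ Yy)) => -[_ _ YZ] _ _; apply: YZ.
  by move=> y /WX Xy; exists X.
have Hn0 : H !=set0.
  have W0 : W 0 by case: sW.
  apply: contrapT => H0; apply: (Hmax W); last by split.
  by split=> [x Hx|Hs]; case: H0; [exists x|exists 0; apply: Hs].
have [sH WH nHv] := PH Hn0; have [H0 HD HZ] := sH.
exists H; split=> // x; have [Hx|nHx] := pselect (H x).
  by exists 0; [exact: divring0|rewrite scale0r subr0].
(* For [x] outside [H], maximality puts [v] in [H + C x], say [v = h + c x]. Here [c] is nonzero
   since [v] is not in [H], so the equation can be solved for [x] modulo [H]. *)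
pose X := [set y | exists2 h, H h & exists2 c, C c & y = h + c *: x].
have XH : H `<=` X.
  by move=> h Hh; exists h => //; exists 0; [exact: divring0|rewrite scale0r addr0].
have sX : subspace X.
  split; first exact: XH.
    move=> _ _ [h Hh [c Cc ->]] [k Hk [d Cd ->]].
    exists (h + k); first exact: HD.
    by exists (c + d); [exact: divringD|rewrite scalerDl addrACA].
  move=> d _ Cd [h Hh [c Cc ->]]; exists (d *: h); first exact: HZ.
  by exists (d * c); [exact: divringM|rewrite scalerDr scalerA].
have [h Hh [c Cc def_v]] : X v.
  apply: contrapT => nXv; apply: (Hmax X).
    split=> // XsubH; apply/nHx/XsubH; exists 0 => //.
    by exists 1; [exact: divring1|rewrite scale1r add0r].
  by move=> _; split=> // y Wy; apply/XH/WH.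
have uc : c \is a GRing.unit.
  by apply: hE; apply/eqP => c0; apply: nHv; rewrite def_v c0 scale0r addr0.
exists c^-1; first exact: divringV.
rewrite def_v scalerDr scalerA mulVr // scale1r opprD addrCA subrr addr0.
rewrite -sub0r; apply: subspaceB => //.
by apply: HZ => //; apply: divringV.
Qed.

(** With [H] a hyperplane as above, [phi x] is the coefficient [c] with [x - c v] in [H]. Its
    uniqueness, [phiE], gives linearity and the prescribed values. *)
Lemma separating_functional (V : lmodType E) (W : set V) v :
  subspace W -> ~ W v ->
  exists phi : V -> E,
    [/\ functional phi, phi v = 1 & forall w, W w -> phi w = 0].
Proof.
move=> sW nWv; have [H [sH WH nHv Hc]] := separating_hyperplane sW nWv.
have [H0 HD HZ] := sH.
have /choice[phi phiP] : forall x, exists c, C c /\ H (x - c *: v).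
  by move=> x; have [c] := Hc x; exists c.
have phiE x c : C c -> H (x - c *: v) -> phi x = c.
  (* Two distinct coefficients would put a nonzero [C]-multiple of [v], hence [v] itself, in [H]. *)
  move=> Cc Hx; have [Cp Hp] := phiP x.
  apply/eqP; rewrite -subr_eq0; apply/negP => /negP/hE ud; apply: nHv.
  have /HZ : H ((phi x - c) *: v).
    have -> : (phi x - c) *: v = (x - c *: v) - (x - phi x *: v).
      by rewrite scalerBl opprB [RHS]addrC addrA subrK.
    exact: subspaceB.
  move/(_ (phi x - c)^-1); rewrite scalerA mulVr // scale1r; apply.
  exact/divringV/divringB.
exists phi; split.
- split=> [x y|c x Cc|x]; last by case: (phiP x).
    have [Cx Hx] := phiP x; have [Cy Hy] := phiP y.
    apply: phiE; first exact: divringD.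
    by rewrite scalerDl opprD addrACA; apply: HD.
  have [Cx Hx] := phiP x; apply: phiE; first exact: divringM.
  by rewrite -scalerA -scalerBr; apply: HZ.
- by apply: phiE; [exact: divring1|rewrite scale1r subrr].
- move=> w /WH Hw; apply: phiE; first exact: divring0.
  by rewrite scale0r subr0.
Qed.

(** Separation of [v k] from the [C]-span of the [v i] with [i] in [A]. This dichotomy drives both
    support inductions below. *)
Lemma family_functional (V : lmodType E) (I : finType) (v : I -> V)
    (A : {set I}) k :
  (exists2 c : I -> E, forall i, C (c i) & v k = \sum_(i in A) c i *: v i) \/
  exists phi : V -> E,
    [/\ functional phi, phi (v k) = 1 & forall i, i \in A -> phi (v i) = 0].
Proof.
pose W := [set w | exists2 c : I -> E, forall i, C (c i) &
                   w = \sum_(i in A) c i *: v i].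
have [|nWv] := pselect (W (v k)); [by left|right].
have [|phi [fphi phi1 phi0]] := separating_functional _ nWv.
  split.
  - exists (fun=> 0) => [_|]; first exact: divring0.
    by rewrite big1 // => i _; rewrite scale0r.
  - move=> _ _ [c Cc ->] [d Cd ->]; exists (fun i => c i + d i) => [i|].
      exact: divringD.
    by rewrite -big_split; apply: eq_bigr => i _; rewrite scalerDl.
  - move=> d _ Cd [c Cc ->]; exists (fun i => d * c i) => [i|].
      exact: divringM.
    by rewrite scaler_sumr; apply: eq_bigr => i _; rewrite scalerA.
exists phi; split=> // i iA; apply: phi0.
exists (fun j => if j == i then 1 else 0) => [j|].
  by case: eqP => _; [exact: divring1|exact: divring0].
rewrite (bigD1 i) //= eqxx scale1r big1 ?addr0 // => j /andP[_ /negPf->].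
by rewrite scale0r.
Qed.

End DivisionSubring.

(** * Contraction of the right tensor factor with a form *)

Section Contract.
Variables (E : unitRingType) (C : set E) (M V : bimodType E) (phi : V -> E).
Hypothesis fphi : functional C phi.

Definition contract : tensor C M V -> M := tlift (fun m v => m :* phi v).

Lemma contract_balanced : balanced C (fun (m : M) v => m :* phi v).
Proof.
case: fphi => phiD phiZ _; split=> [m m' v|m v v'|m c v Cc].
- by rewrite rscalerDl.
- by rewrite phiD rscalerDr.
- by rewrite rscalerA phiZ.
Qed.

Lemma contract_tens m v : contract (tens C m v) = m :* phi v.
Proof. exact/tlift_tens/contract_balanced. Qed.

Lemma contractD : {morph contract : s t / s + t}.
Proof. exact/tliftD/contract_balanced. Qed.

Lemma contractZ a t : contract (a *: t) = a *: contract t.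
Proof.
elim/tens_ind: t => [m v|s t IHs IHt].
  by rewrite scale_tens !contract_tens scaler_rscale.
by rewrite scalerDr !contractD IHs IHt scalerDr.
Qed.

End Contract.

(** * Finite sums and tensors *)

Lemma tens0r (E : nzRingType) (C : set E) (M N : bimodType E) (m : M) :
  tens C m (0 : N) = 0.
Proof. by apply: (addrI (tens C m 0)); rewrite -tensDr !addr0. Qed.

Lemma tens_sumr (E : nzRingType) (C : set E) (M N : bimodType E) (I : Type)
    (r : seq I) (P : pred I) (m : M) (n : I -> N) :
  \sum_(i <- r | P i) tens C m (n i) = tens C m (\sum_(i <- r | P i) n i).
Proof.
apply: (big_ind2 (fun a b => a = tens C m b)) => //; first by rewrite tens0r.
by move=> _ b _ d -> ->; rewrite tensDr.
Qed.

Lemma additive_sum (U V : zmodType) (f : U -> V) (I : Type) (r : seq I)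
    (P : pred I) (F : I -> U) :
  {morph f : x y / x + y} ->
  f (\sum_(i <- r | P i) F i) = \sum_(i <- r | P i) f (F i).
Proof. by move=> fD; apply: big_morph => //; apply: additive0. Qed.

Lemma rscale0r (E : nzRingType) (V : bimodType E) (v : V) : v :* 0 = 0.
Proof. by apply: (addrI (v :* 0)); rewrite -rscalerDr !addr0. Qed.

Lemma rscale0l (E : nzRingType) (V : bimodType E) a : (0 : V) :* a = 0.
Proof. by apply: (addrI ((0 : V) :* a)); rewrite -rscalerDl !addr0. Qed.

Lemma tensor_sum (E : nzRingType) (D : set E) (M N : bimodType E)
    (t : tensor D M N) :
  exists n (x : 'I_n -> M) (y : 'I_n -> N), t = \sum_i tens D (x i) (y i).
Proof.
elim/tens_ind: t => [m n|_ _ [p [x [y ->]]] [q [x' [y' ->]]]].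
  by exists 1, (fun=> m), (fun=> n); rewrite big_ord1.
pose glue T (a : 'I_p -> T) (b : 'I_q -> T) (i : 'I_(p + q)) :=
  match split i with inl j => a j | inr j => b j end.
exists (p + q)%N, (glue _ x x'), (glue _ y y').
rewrite big_split_ord; congr (_ + _); apply: eq_bigr => i _; rewrite /glue.
  by rewrite -[lshift _ _]/(unsplit (inl i)) unsplitK.
by rewrite -[rshift _ _]/(unsplit (inr i)) unsplitK.
Qed.

Lemma regular_scale (E : nzRingType) (a : E) (x : E^o) : a *: x = a * (x : E) :> E^o.
Proof. by []. Qed.

Lemma regular_rscale (E : nzRingType) (x : E^o) (a : E) : x :* a = (x : E) * a :> E^o.
Proof. by []. Qed.

(** * Relations satisfied by a group-like element *)

Section Division.
Variable E : unitRingType.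
Hypothesis hE : forall x : E, x != 0 -> x \is a GRing.unit.

Lemma divring_closedT : GRing.divring_closed [in [set: E]%classic].
Proof. by split=> [|x y _ _|x y _ _]; apply/mem_set. Qed.

(* Applying [phi] to the relation, and [id (x) phi] to its comultiplication,
   gives [\sum_i g x_i phi(g y_i) = 0] and [\sum_i x_i g phi(g y_i) = 0]; in
   the difference only the term [j] survives. *)
Lemma grouplike_central_coef (B : coring E) (g : B) (I : finType)
    (x y : I -> E) (phi : B -> E) j :
  comul g = tens [set: E]%classic g g -> functional [set: E]%classic phi -> phi (g :* y j) = 1 ->
  (forall i, i != j -> x i *: g = g :* x i \/ phi (g :* y i) = 0) ->
  \sum_i x i *: (g :* y i) = 0 -> x j *: g = g :* x j.
Proof.
move=> gg fphi phi1 phi0 xy0; have [phiD phiZ _] := fphi.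
have dB := comul_hom B.
have l : \sum_i (x i *: g) :* phi (g :* y i) = 0.
  transitivity (contract phi (comul (\sum_i x i *: (g :* y i)))).
    rewrite (additive_sum _ _ _ (bimod_homD dB)) (additive_sum _ _ _ (contractD fphi)).
    apply: eq_bigr => i _; rewrite (bimod_homZ _ _ dB) (bimod_homR _ _ dB) gg.
    by rewrite rscale_tens scale_tens contract_tens.
  by rewrite xy0 (additive0 (bimod_homD dB)) (additive0 (contractD fphi)).
have r : \sum_i (g :* x i) :* phi (g :* y i) = 0.
  transitivity (g :* phi (\sum_i x i *: (g :* y i))).
    rewrite (additive_sum _ _ _ phiD).
    rewrite (additive_sum _ _ _ (rscalerDr g)).
    by apply: eq_bigr => i _; rewrite phiZ // rscalerA.
  by rewrite xy0 (additive0 phiD) rscale0r.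
have : \sum_i ((x i *: g) :* phi (g :* y i) - (g :* x i) :* phi (g :* y i)) = 0.
  by rewrite sumrB l r subrr.
rewrite (bigD1 j) //= big1 => [|i /phi0[->|->]]; rewrite ?subrr //.
  by rewrite phi1 !rscaler1 addr0 => /subr0_eq.
by rewrite !rscale0r subrr.
Qed.

Local Notation supp x := [set i | x i != 0].

(** Induction on the number of nonzero [x i], one of them, [x k], scaled to [1]. If the [g y_j] for
    the other [j] in the support are left independent over [E], all [x i] commute with [g];
    otherwise a dependence among them splits the relation into two with smaller support. *)
Lemma grouplike_kernel (B : coring E) (g : B) (I : finType) (x y : I -> E) :
  comul g = tens [set: E]%classic g g -> counit g = 1 ->
  \sum_i x i *: (g :* y i) = 0 ->
  \sum_i tens [set e | e *: g = g :* e]%classic (x i : E^o) (y i : E^o) = 0.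
Proof.
move=> gg g1; set C := (X in tens X).
have [m] := ubnP #|supp x|; elim: m x => // m IH x lt_m xy0.
have [s0|[k]] := set_0Vmem (supp x).
  rewrite big1 // => i _; have : i \notin supp x by rewrite s0 inE.
  by rewrite inE negbK => /eqP ->; rewrite tens0l.
rewrite inE => xk0; have uk := hE xk0.
wlog xk1 : x lt_m xy0 xk0 uk / x k = 1.
  move=> gen; have uV : (x k)^-1 \is a GRing.unit by rewrite unitrV.
  have lt' : (#|supp (fun i => (x k)^-1 * x i)%R| < m.+1)%N.
    apply: leq_ltn_trans lt_m; apply/subset_leq_card/fintype.subsetP => i.
    by rewrite !inE; apply: contra_neq => ->; rewrite mulr0.
  have xy' : \sum_i ((x k)^-1 * x i) *: (g :* y i) = 0.
    rewrite -[RHS](scaler0 _ (x k)^-1) -[in RHS]xy0 scaler_sumr.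
    by apply: eq_bigr => i _; rewrite scalerA.
  have := gen _ lt' xy'; rewrite mulVr // oner_eq0 unitr1 => /(_ isT isT erefl) H.
  rewrite -[LHS]scale1r -(divrr uk) -scalerA scaler_sumr.
  rewrite -[RHS](scaler0 _ (x k)) -[in RHS]H; congr (_ *: _).
  by apply: eq_bigr => i _; rewrite scale_tens.
pose A := supp x :\ k.
have ltA : (#|A| < m)%N.
  by move: lt_m; rewrite (cardsD1 k) inE xk0 add1n ltnS.
have [indep|] := pselect (forall j, j \in A -> exists phi : B -> E,
  [/\ functional [set: E]%classic phi, phi (g :* y j) = 1 &
      forall i, i \in A :\ j -> phi (g :* y i) = 0]).
  have Cx i : C (x i).
    have [iA|] := boolP (i \in A); last first.
      rewrite !inE negb_and !negbK => /orP[/eqP->|/eqP->].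
        by rewrite /C /= xk1 scale1r rscaler1.
      by rewrite /C /= scale0r rscale0r.
    have [phi [fphi phi1 phi0]] := indep _ iA.
    (* The value of [phi] at [g y_k] is unknown, but [x k = 1] commutes with [g]. *)
    apply: grouplike_central_coef gg fphi phi1 _ xy0 => j ji.
    have [jA|] := boolP (j \in A); first by right; apply: phi0; rewrite in_setD1 ji.
    rewrite !inE negb_and !negbK => /orP[/eqP->|/eqP->]; left.
      by rewrite xk1 scale1r rscaler1.
    by rewrite scale0r rscale0r.
  (* Every [x i] now crosses the tensor sign, and the counit of the relation gives
     [\sum_i x_i y_i = 0]. *)
  transitivity (\sum_i tens C (1 : E^o) (x i * y i : E^o)).
    apply: eq_bigr => i _.
    by rewrite -[x i in LHS]mul1r -regular_rscale tens_bal.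
  rewrite tens_sumr -[X in tens _ _ X]/(\sum_i x i * y i : E).
  suff -> : \sum_i x i * y i = 0 by rewrite tens0r.
  have eB := counit_hom B.
  rewrite -[RHS](additive0 (bimod_homD eB)) -xy0 (additive_sum _ _ _ (bimod_homD eB)).
  apply: eq_bigr => i _.
  by rewrite (bimod_homZ _ _ eB) (bimod_homR _ _ eB) g1 regular_rscale mul1r.
move/existsNP => [j /not_implyP[jA dep]].
have [[c _ def_j]|[phi]] := family_functional hE divring_closedT
    (fun i => g :* y i : B) (A :\ j) j; last first.
  move=> hphi; case: dep; exists phi; exact: hphi.
(* The dependence of [g y_j] as a relation with coefficient [-1] at [j]. Its support lies in [A],
   which misses [k], so the induction hypothesis applies. *)
pose z i := if i == j then -1 else if i \in A :\ j then c i else 0.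
have zA i : i \notin A -> z i = 0.
  move=> iA; rewrite /z in_setD1 (negPf iA) andbF; case: eqP => // ij.
  by rewrite ij jA in iA.
have zy0 : \sum_i z i *: (g :* y i) = 0.
  rewrite (bigD1 j) //= {1}/z eqxx scaleN1r def_j; apply/eqP.
  rewrite addrC subr_eq0; apply/eqP.
  rewrite [RHS]big_mkcond [LHS]big_mkcond; apply: eq_bigr => i _.
  rewrite /z; case: eqP => [->|_] /=; first by rewrite in_setD1 eqxx.
  by case: ifP => // _; rewrite scale0r.
have z0 : \sum_i tens C (z i : E^o) (y i : E^o) = 0.
  apply: IH.
    apply: leq_ltn_trans ltA; apply/subset_leq_card/fintype.subsetP => i.
    by rewrite inE; apply: contraR => /zA ->; rewrite eqxx.
  exact: zy0.
(* Adding [x j] times [z] cancels the coefficient at [j] and creates no new index in the support. *)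
pose x' i := x i + x j * z i.
have x'j : x' j = 0 by rewrite /x' /z eqxx mulrN1 subrr.
have sx' : supp x' \subset supp x :\ j.
  apply/fintype.subsetP => i; rewrite !inE => x'i; apply/andP; split.
    by apply: contra_neq x'i => ->.
  apply: contra_neq x'i => xi; rewrite /x' xi zA ?mulr0 ?addr0 //.
  by rewrite !inE xi eqxx andbF.
have jx : j \in supp x by move: jA; rewrite in_setD1 => /andP[].
have t0 : \sum_i tens C (x' i : E^o) (y i : E^o) = 0.
  apply: IH.
    apply: leq_ltn_trans (subset_leq_card sx') _.
    by move: lt_m; rewrite (cardsD1 j) jx add1n ltnS.
  transitivity (\sum_i x i *: (g :* y i) + x j *: \sum_i z i *: (g :* y i)).
    rewrite scaler_sumr -big_split /=; apply: eq_bigr => i _.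
    by rewrite scalerA -scalerDl.
  by rewrite xy0 zy0 scaler0 addr0.
rewrite -[RHS]t0 -[LHS]addr0.
transitivity (\sum_i tens C (x i : E^o) (y i : E^o) +
              x j *: \sum_i tens C (z i : E^o) (y i : E^o)).
  by rewrite z0 scaler0.
rewrite scaler_sumr -big_split; apply: eq_bigr => i _ /=.
by rewrite scale_tens -tensDl.
Qed.

(** * Group-like elements of the Sweedler coring of a division subring *)

Section Functionals.
Variable C : set E.
Hypothesis hC : GRing.divring_closed [in C].

(** Induction on the number of nonzero [x i]. If [y k] is a [C]-combination of the other [y i] in
    the support, its term is absorbed by moving the coefficients to the left factors; otherwise a
    form that is [1] at [y k] and [0] at those [y i] contracts [t] to [x k], a contradiction. *)
Lemma contract_eq0 (t : tensor C E^o E^o) :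
  (forall phi : E^o -> E, functional C phi -> contract phi t = 0) -> t = 0.
Proof.
have [n [x [y ->]]] := tensor_sum t.
have [m] := ubnP #|supp (x : _ -> E)|; elim: m x => // m IH x lt_m t0.
have [s0|[k]] := set_0Vmem (supp (x : _ -> E)).
  rewrite big1 // => i _; have : i \notin supp (x : _ -> E) by rewrite s0 inE.
  by rewrite inE negbK => /eqP ->; rewrite tens0l.
move=> kx; pose A := supp (x : _ -> E) :\ k.
have xA i : i \notin A -> i != k -> x i = 0.
  by rewrite !inE negb_and !negbK => /orP[->|/eqP].
have kA : k \notin A by rewrite !inE eqxx.
have [[c Cc def_k]|[phi [fphi phi1 phi0]]] := family_functional hE hC y A k.
  have tx : \sum_i tens C (x i) (y i) =
            \sum_i tens C (if i \in A then x i + x k * c i else 0 : E^o) (y i).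
    rewrite (bigD1 k) //= [RHS](bigD1 k) //= (negPf kA) tens0l add0r.
    rewrite def_k -tens_sumr big_mkcond [X in X + _](bigD1 k) //= (negPf kA) add0r.
    rewrite -big_split /=; apply: eq_bigr => i ik.
    case: ifPn => [iA|/xA ->//]; last by rewrite tens0l add0r.
    by rewrite tensDl addrC -tens_bal.
  rewrite tx in t0 *; apply: IH => //.
  apply: leq_ltn_trans (_ : #|A| < m)%N; last first.
    by move: lt_m; rewrite (cardsD1 k) kx add1n ltnS.
  apply/subset_leq_card/fintype.subsetP => i; rewrite inE.
  by case: ifP => //; rewrite eqxx.
have := t0 _ fphi; rewrite (additive_sum _ _ _ (contractD fphi)) (bigD1 k) //=.
rewrite big1 => [|i ik]; rewrite contract_tens //.
  rewrite phi1 rscaler1 addr0 => xk0.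
  by move: kx; rewrite inE xk0 eqxx.
have [/phi0->|/xA->//] := boolP (i \in A); first by rewrite rscale0r.
by rewrite rscale0l.
Qed.

(** For [e] outside [C], a form vanishing on [C] with value [1] at [e] contracts [e (x) 1] to [0]
    and [1 (x) e] to [1]. *)
Lemma commute_tens11 (e : E) :
  tens C (e : E^o) (1 : E^o) = tens C (1 : E^o) (e : E^o) <-> C e.
Proof.
split=> [e11|Ce]; last first.
  by rewrite -{1}(regular_rscale1 (e : E^o)) tens_bal // regular_scale1.
apply: contrapT => nCe.
have sC : subspace C (C : set E^o).
  by split; [exact: divring0|exact: divringD|exact: divringM].
have [phi [fphi phi1 phi0]] := separating_functional hE hC sC nCe.
have := congr1 (contract phi) e11.
rewrite !contract_tens // phi1 phi0; last exact: divring1.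
by rewrite rscale0r rscaler1 => /eqP; rewrite eq_sym oner_eq0.
Qed.

Local Notation g := (sweedler_grouplike C).

Lemma scale_grouplike (a : E) : a *: g = tens C (a : E^o) (1 : E^o).
Proof. by rewrite [LHS]scale_tens regular_scale1. Qed.

Lemma rscale_grouplike (a : E) : g :* a = tens C (1 : E^o) (a : E^o).
Proof. by rewrite [LHS]rscale_tens regular_rscale1. Qed.

Lemma commute_grouplike (e : E) : e *: g = g :* e <-> C e.
Proof. rewrite scale_grouplike rscale_grouplike; exact: commute_tens11. Qed.

(* Applying [id (x) contract phi] to [\Delta h = h (x) h] gives
   [contract phi h * g = h * contract phi h]. *)
Lemma grouplike_conj (h : sweedler C) :
  comul h = tens [set: E]%classic h h -> counit h = 1 ->
  exists2 a : E, a != 0 & a *: g = h :* a.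
Proof.
move=> hh h1.
(* Since [h] has counit [1] it is nonzero, so some form does not contract it to zero. *)
have [phi fphi phih] : exists2 phi : E^o -> E, functional C phi & contract phi h != 0 :> E.
  apply: contrapT => no; suff h0 : h = 0.
    move: h1; rewrite h0 (additive0 (bimod_homD (counit_hom _))) => /esym/eqP.
    by rewrite oner_eq0.
  apply: contract_eq0 => phi fphi; apply: contrapT => /eqP ph.
  by apply: no; exists phi.
pose Phi : sweedler C -> E := contract phi.
have fPhi : functional [set: E]%classic Phi.
  by split=> [|c x _|//]; [exact: contractD|exact: (contractZ fphi c x)].
exists (Phi h) => //.
rewrite -(contract_tens fPhi) -hh.
(* On [x (x) y] both sides equal [x phi(y) (x) 1], because [phi y] lies in [C]. *)
have : forall t, Phi t *: g = contract Phi (sweedler_comul t).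
  apply: tens_ext => [s t|s t|x y].
  - by rewrite [Phi _](contractD fphi) scalerDl.
  - by rewrite (bimod_homD (sweedler_comul_hom _)) (contractD fPhi).
  - rewrite sweedler_comul_tens (contract_tens fPhi) /Phi !contract_tens //.
    have [_ _ Cphi] := fphi.
    rewrite rscale_tens regular_rscale1 !regular_rscale mul1r.
    rewrite scale_grouplike -regular_rscale tens_bal //.
    by rewrite regular_scale1.
by apply.
Qed.

End Functionals.

End Division.

(** * Isomorphisms of corings *)

Section CoringIso.
Variable E : nzRingType.
Implicit Types A B : coring E.

Lemma tmap_id (D : set E) (M N : bimodType E) (t : tensor D M N) : tmap id id t = t.
Proof.
have hM := @bimod_hom_id E M; have hN := @bimod_hom_id E N.
move: t; apply: tens_hom_ext => [||m n]; [exact: tmap_hom|exact: bimod_hom_id|].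
by rewrite tmap_tens //; apply: bimod_hom_tmapable.
Qed.

Lemma coring_hom_comp A B (B' : coring E) (f : B -> B') (g : A -> B) :
  coring_hom f -> coring_hom g -> coring_hom (f \o g).
Proof.
move=> [fh fC fe] [gh gC ge]; split=> [|c|c] /=; first exact: bimod_hom_comp.
  by rewrite fC gC tmap_comp.
by rewrite fe ge.
Qed.

Lemma coring_hom_inv A B (f : A -> B) (g : B -> A) :
  coring_hom f -> cancel f g -> cancel g f -> coring_hom g.
Proof.
move=> [fh fC fe] fK gK; have gh : bimod_hom g.
  apply: bimod_hom_of => [x y|a x|x a]; apply: (can_inj fK); rewrite gK.
  - by rewrite (bimod_homD fh) !gK.
  - by rewrite (bimod_homZ _ _ fh) gK.
  - by rewrite (bimod_homR _ _ fh) gK.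
split=> // c; last by rewrite -fe gK.
rewrite -{2}(gK c) fC tmap_comp //.
have -> : g \o f = id by apply/funext => x /=; rewrite fK.
by rewrite tmap_id.
Qed.

Lemma coring_iso_of_bij A B (f : A -> B) :
  coring_hom f -> bijective f -> coring_iso A B.
Proof.
move=> fh [g fK gK]; exists f, g; split=> //.
exact: coring_hom_inv fh fK gK.
Qed.

Lemma coring_iso_sym A B : coring_iso A B -> coring_iso B A.
Proof. by move=> [f [g [fh gh fK gK]]]; exists g, f. Qed.

Lemma coring_iso_trans B A (B' : coring E) :
  coring_iso A B -> coring_iso B B' -> coring_iso A B'.
Proof.
move=> [f [g [fh gh fK gK]]] [f' [g' [fh' gh' fK' gK']]].
exists (f' \o f), (g \o g'); split; try exact: coring_hom_comp.
  exact: can_comp.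
exact: can_comp.
Qed.

(** First isomorphism theorem, with the map built from [B] to the quotient: a section [s] of [f]
    followed by the projection. By [hf] the choice of section is immaterial. *)
Lemma quot_coring_iso A B (f : A -> B) (J : coideal A) :
  coring_hom f -> (forall b, exists c, f c = b) ->
  coideal_set J = [set c | f c = 0]%classic -> coring_iso (quot_coring J) B.
Proof.
move=> fh fs JE; have [fb fC fe] := fh; have hp := quot_proj_hom J.
have projE x y : quot_proj J x = quot_proj J y <-> f x = f y.
  rewrite quot_projP JE /= (bimod_homB fb).
  by split=> [/subr0_eq|->]; rewrite ?subrr.
have /choice[s sK] := fs.
pose h (b : B) : quot_coring J := quot_proj J (s b).
have hf c : h (f c) = quot_proj J c by apply/projE; rewrite sK.
apply: coring_iso_sym; apply: (@coring_iso_of_bij _ _ h); last first.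
  exists (fun q => f (quot_repr q)) => [b|q].
    by rewrite -[RHS]sK; apply/projE; rewrite quot_reprK.
  by rewrite hf quot_reprK.
have hh : bimod_hom h.
  apply: bimod_hom_of => [b b'|a b|b a].
  - have [x <-] := fs b; have [x' <-] := fs b'.
    by rewrite -(bimod_homD fb) !hf; exact: (bimod_homD hp).
  - by have [x <-] := fs b; rewrite -(bimod_homZ _ _ fb) !hf; exact: (bimod_homZ _ _ hp).
  - by have [x <-] := fs b; rewrite -(bimod_homR _ _ fb) !hf; exact: (bimod_homR _ _ hp).
split=> // b; have [x <-] := fs b.
  rewrite hf fC tmap_comp //.
  have -> : h \o f = quot_proj J by apply/funext => c /=; rewrite hf.
  exact: quot_comul_proj.
by rewrite hf fe; exact: quot_counit_proj.
Qed.

End CoringIso.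

(** * Transport and conjugation of group-like elements *)

Lemma coring_hom_grouplike (E : nzRingType) (A B : coring E) (f : A -> B) g :
  coring_hom f -> comul g = tens [set: E]%classic g g -> counit g = 1 ->
  comul (f g) = tens [set: E]%classic (f g) (f g) /\ counit (f g) = 1.
Proof.
move=> [fh fC fe] gg g1; split; last by rewrite fe.
by rewrite fC gg tmap_tens //; apply: bimod_hom_tmapable.
Qed.

Lemma sweedler_grouplikeP (E : nzRingType) (D : set E) (g := sweedler_grouplike D) :
  comul g = tens [set: E]%classic g g /\ counit g = 1.
Proof.
by split; [exact: sweedler_comul_tens|rewrite [LHS]sweedler_counit_tens mulr1].
Qed.

(** The hypothesis says [w = a^-1 v a], so the commutant of [w] is that of [v] conjugated by
    [a^-1]. *)
Lemma commute_conj (E : unitRingType) (V : bimodType E) (v w : V) (a c : E) :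
  a \is a GRing.unit -> a *: w = v :* a ->
  c *: v = v :* c <-> (a^-1 * c * a) *: w = w :* (a^-1 * c * a).
Proof.
move=> ua aw; have wa : w = a^-1 *: (v :* a) by rewrite -aw scalerA mulVr // scale1r.
have l : (a^-1 * c * a) *: w = a^-1 *: (c *: v :* a).
  by rewrite -scalerA aw -scalerA scaler_rscale.
have r : w :* (a^-1 * c * a) = a^-1 *: (v :* c :* a).
  by rewrite wa !scaler_rscale !rscalerA !mulrA mulrV // mul1r.
rewrite l r; split=> [->//|/(congr1 (fun x => a *: x :* a^-1))].
by rewrite !scalerA mulrV // !scale1r !rscalerA mulrV // rscaler1 mulr1.
Qed.

(** * Conjugated subrings and isomorphic Sweedler corings *)

Section Conjugation.
Variable E : unitRingType.

(** Inserting [u^-1] and [u] in the middle keeps the map [E]-linear on both sides; it sends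
    [1 (x) 1] to the group-like element [u^-1 (1 (x) 1) u]. *)
Definition conj_map (C C' : set E) (u : E) : sweedler C -> sweedler C' :=
  tlift (fun x y : E^o => tens C' ((x : E) * u^-1 : E^o) (u * (y : E) : E^o)).

Arguments conj_map C C' u t : clear implicits.

Section Balanced.
Variables (C C' : set E) (u : E).
Hypotheses (Uu : u \is a GRing.unit) (sub : forall c, C c -> C' (u * c * u^-1)).

Lemma conj_map_balanced :
  balanced C (fun x y : E^o => tens C' ((x : E) * u^-1 : E^o) (u * (y : E) : E^o)).
Proof.
split=> [x x' y|x y y'|x c y Cc].
- by rewrite mulrDl tensDl.
- by rewrite mulrDr tensDr.
- rewrite regular_rscale regular_scale.
  have -> : x * c * u^-1 = (x * u^-1) * (u * c * u^-1) by rewrite !mulrA mulrVK.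
  by rewrite -regular_rscale tens_bal ?regular_scale ?mulrA ?mulrVK //; apply: sub.
Qed.

Lemma conj_map_tens x y :
  conj_map C C' u (tens C x y) = tens C' (x * u^-1 : E^o) (u * y : E^o).
Proof. exact/tlift_tens/conj_map_balanced. Qed.

Lemma conj_map_coring_hom : coring_hom (conj_map C C' u).
Proof.
have h : bimod_hom (conj_map C C' u).
  apply: tlift_hom => [|a x y|x y a]; first exact: conj_map_balanced.
    by rewrite scale_tens !regular_scale mulrA.
  by rewrite rscale_tens !regular_rscale mulrA.
split=> //.
- apply: tens_hom_ext => [||x y].
  + exact: (@bimod_hom_comp _ _ _ _ (@comul _ (sweedler C')) _ (comul_hom _) h).
  + apply: (@bimod_hom_comp _ _ _ _ (tmap _ _) _ _ (comul_hom (sweedler C))).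
    by apply: tmap_hom; exact: h.
  + rewrite conj_map_tens /= !sweedler_comul_tens.
    rewrite tmap_tens; last exact: (bimod_hom_tmapable _ h h).
    rewrite !conj_map_tens mulr1 mul1r.
    (* The inner [u] and [u^-1] cancel across the tensor product over [E]. *)
    have -> : tens C' (x / u : E^o) (u : E^o) = tens C' (x / u : E^o) (1 : E^o) :* u.
      by rewrite rscale_tens regular_rscale mul1r.
    rewrite [RHS]tens_bal //.
    by rewrite scale_tens regular_scale divrr.
- apply: tens_hom_ext => [||x y].
  + exact: (@bimod_hom_comp _ _ _ _ (@counit _ (sweedler C')) _ (counit_hom _) h).
  + exact: counit_hom (sweedler C).
  + by rewrite conj_map_tens /= !sweedler_counit_tens mulrA mulrVK.
Qed.

End Balanced.

Lemma conj_mapK (C C' : set E) (u : E) : u \is a GRing.unit ->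
  (forall c, C c -> C' (u * c * u^-1)) -> (forall c, C' c -> C (u^-1 * c * u)) ->
  cancel (conj_map C C' u) (conj_map C' C u^-1).
Proof.
move=> Uu CC' C'C.
have UV : u^-1 \is a GRing.unit by rewrite unitrV.
have C'C' c : C' c -> C (u^-1 * c * u^-1^-1) by rewrite invrK; apply: C'C.
have [h _ _] := conj_map_coring_hom Uu CC'.
have [h' _ _] := conj_map_coring_hom UV C'C'.
apply: tens_hom_ext => [||x y].
- exact: (bimod_hom_comp h' h).
- exact: bimod_hom_id.
- by rewrite (conj_map_tens Uu) // (conj_map_tens UV) // mulrK // mulKr.
Qed.

Lemma conjugated_iso (C C' : set E) :
  conjugated C C' -> coring_iso (sweedler C) (sweedler C').
Proof.
case=> u Uu C'E.
have CC' c : C c -> C' (u * c * u^-1) by move=> Cc; rewrite C'E; exists c.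
have C'C c : C' c -> C (u^-1 * c * u).
  by rewrite C'E => -[d Cd <-]; rewrite !mulrA mulVr // mul1r mulrVK.
exists (conj_map C C' u), (conj_map C' C u^-1); split.
- exact: conj_map_coring_hom.
- by apply: conj_map_coring_hom => [|c /C'C]; rewrite ?unitrV ?invrK.
- exact: conj_mapK.
- rewrite -{2}[u]invrK; apply: conj_mapK => [|c /C'C|c /CC'];
  by rewrite ?unitrV ?invrK.
Qed.

Hypothesis hE : forall x : E, x != 0 -> x \is a GRing.unit.

(** As [f] is injective, [f g] has the commutant [C] of [g]; being conjugate to [g'] by [a], it also
    has commutant [a C' a^-1]. The conjugating unit is therefore [a^-1]. *)
Lemma iso_conjugated (C C' : set E) :
  GRing.divring_closed [in C] -> GRing.divring_closed [in C'] ->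
  coring_iso (sweedler C) (sweedler C') -> conjugated C C'.
Proof.
move=> hC hC' [f [f' [fh _ fK _]]]; have [fb _ _] := fh.
have [gg g1] := sweedler_grouplikeP C.
set g := sweedler_grouplike C in gg g1.
have [hh h1] := coring_hom_grouplike fh gg g1.
have [a a0 ag] := grouplike_conj hE hC' hh h1.
set g' := sweedler_grouplike C' in ag.
have ua := hE a0.
have CC' c : C c <-> C' (a^-1 * c * a).
  rewrite -(commute_grouplike hE hC) -(commute_grouplike hE hC') -/g -/g'.
  rewrite -(commute_conj c ua ag) -(bimod_homZ _ _ fb) -(bimod_homR _ _ fb).
  by split=> [->//|]; apply: (can_inj fK).
exists a^-1; first by rewrite unitrV.
apply/seteqP; rewrite invrK; split=> [c C'c|_ [c Cc <-]]; last exact/CC'.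
have ac : a^-1 * (a * c * a^-1) * a = c by rewrite !mulrA mulVr // mul1r mulrVK.
by exists (a * c * a^-1); rewrite // CC' ac.
Qed.

End Conjugation.

(** * The correspondence *)

(** The projection factors through the tensor product over the commutant by [x (x) y |-> x p(g) y],
    which is balanced because the commutant commutes with [p g]. The converse is [grouplike_kernel]
    for the group-like element [p g]. *)
Lemma coideal_kernel (E : unitRingType)
    (hE : forall x : E, x != 0 -> x \is a GRing.unit) (D : divsubring E)
    (J : coideal (sweedler D)) t :
  @sweedler_map E D (commutant J) t = 0 <-> coideal_set J t.
Proof.
have sDC := @commutant_sub E D J.
pose p : sweedler D -> quot_coring J := quot_proj J.
have ph : coring_hom p by exact: quot_proj_coring_hom.
have [pb _ _] := ph.
set g := sweedler_grouplike D.
have pt (x y : E^o) : p (tens D x y) = (x : E) *: (p g :* (y : E)).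
  rewrite -(bimod_homR _ _ pb) -(bimod_homZ _ _ pb); congr p.
  by rewrite rscale_grouplike [RHS]scale_tens regular_scale mulr1.
have pJ : p t = 0 <-> coideal_set J t.
  rewrite -[t in X in _ <-> X]subr0 -quot_projP -/p.
  by rewrite [p 0](additive0 (bimod_homD pb)).
rewrite -pJ; split=> [t0|].
  pose k (x y : E^o) : quot_coring J := (x : E) *: (p g :* (y : E)).
  have kb : balanced (commutant J) k.
    rewrite /k; split=> [x x' y|x y y'|x d y cd].
    - by rewrite scalerDl.
    - by rewrite rscalerDr scalerDr.
    - by rewrite regular_rscale regular_scale -scalerA -rscalerA -scaler_rscale cd.
  suff -> : p t = tlift k (@sweedler_map E D (commutant J) t).
    by rewrite t0; apply/additive0/tliftD.
  move: {t0 pJ} t; apply: tens_ext => [|s t|x y]; first exact: bimod_homD.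
    by rewrite (bimod_homD (sweedler_map_hom sDC)) tliftD.
  by rewrite sweedler_map_tens // tlift_tens.
have [n [x [y ->]]] := tensor_sum t.
rewrite (additive_sum _ _ _ (bimod_homD pb)).
rewrite (additive_sum _ _ _ (bimod_homD (sweedler_map_hom sDC))) => pt0.
have [gg g1] := sweedler_grouplikeP D.
have [hh h1] := coring_hom_grouplike ph gg g1.
rewrite -[RHS](grouplike_kernel hE (x := x) (y := y) hh h1).
  by apply: eq_bigr => i _; exact: sweedler_map_tens.
by rewrite -[RHS]pt0; apply: eq_bigr => i _; apply/esym/pt.
Qed.

Theorem corollary2p6 (E : unitRingType)
    (hE : forall x : E, x != 0 -> x \is a GRing.unit) (D : divsubring E) :
  [/\ cancel (@ring_of_coideal E D) (@coideal_of_ring E D),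
      cancel (@coideal_of_ring E D) (@ring_of_coideal E D) &
      forall C C' : intermediate D,
        conjugated C C' <->
        coring_iso (quot_coring (coideal_of_ring C))
                   (quot_coring (coideal_of_ring C'))].
Proof.
have quot_iso (C : intermediate D) : coring_iso (quot_coring (coideal_of_ring C)) (sweedler C).
  have sDC := @intermediate_sub _ D C.
  apply: (@quot_coring_iso _ _ _ (@sweedler_map E D C)) => //.
    exact: sweedler_map_coring_hom.
  exact: sweedler_map_surj.
split=> [J|C|C C'].
- apply: coideal_inj; apply/seteqP.
  by split=> t /(coideal_kernel hE).
- apply: intermediate_inj; rewrite /= /commutant.
  have [pb _ _] := quot_proj_coring_hom (coideal_of_ring C).
  have sDC := @intermediate_sub _ D C; have sb := sweedler_map_hom sDC.
  have hC := divsubring_closed C.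
  apply/funext => e; apply/propext => /=.
  (* Commuting with the image of [1 (x) 1] means that [e (x) 1 - 1 (x) e] lies in the kernel, that
     is, [e (x) 1 = 1 (x) e] over [C]. *)
  rewrite -(bimod_homZ _ _ pb) -(bimod_homR _ _ pb) quot_projP /=.
  rewrite (bimod_homB sb) scale_grouplike rscale_grouplike !sweedler_map_tens //.
  rewrite -[X in _ <-> X](commute_tens11 hE hC).
  by split=> [/subr0_eq|->]; rewrite ?subrr.
- split=> [cCC'|iCC'].
    apply: coring_iso_trans (quot_iso C) _.
    exact: coring_iso_trans (conjugated_iso cCC') (coring_iso_sym (quot_iso C')).
  apply: (iso_conjugated hE); [exact: divsubring_closed|exact: divsubring_closed|].
  apply: coring_iso_trans (coring_iso_sym (quot_iso C)) _.
  exact: coring_iso_trans iCC' (quot_iso C').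
Qed.
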